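(* Let $k=\mathbb{Q}(t_1,t_2,t_3,t_4)$ be a purely transcendental extension of $\mathbb{Q}$ of transcendence degree $4$, let $E/k$ be the elliptic curve $y^2=x(x-t_1)(x-t_2)$, and let $K=k(x)[y]/(y^2-x(x-t_1)(x-t_2))$ be its function field. Then the central simple algebra $A=\langle x,t_3\rangle\otimes\langle x-t_1,t_4\rangle$ over $K$ has index $4$ (i.e. is a division algebra).
   Context: For a field $L$ and $u,v\in L^*$, $\langle u,v\rangle$ denotes the quaternion algebra over $L$ generated by $i,j$ with $i^2=u$, $j^2=v$, $ij=-ji$. The index of a central simple algebra is the index of its Brauer class. *)

(* Defs.v *)
From HB Require Import structures.
From mathcomp Require Import all_boot all_order all_algebra.
From mathcomp Require Import fraction qpoly.
From mathcomp Require Import mpoly.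
Set Implicit Arguments. Unset Strict Implicit. Unset Printing Implicit Defensive.
Import Order.TTheory GRing.Theory Num.Theory.
Local Open Scope ring_scope.

(* Quaternion algebras <u,v> over a commutative ring R, with K-basis      *)
(* i^a j^b (a,b in {0,1}), indexed by qidx = bool * bool.                 *)
(* (i^a j^b)(i^c j^d) = (-1)^(b c) u^(a c) v^(b d) i^(a xor c) j^(b xor d) *)
Definition qidx := (bool * bool)%type.
Definition qxor (e f : qidx) : qidx := (xorb e.1 f.1, xorb e.2 f.2).

Definition quat_coef (R : comNzRingType) (u v : R) (e f : qidx) : R :=
  (-1) ^+ (e.2 && f.1) * u ^+ (e.1 && f.1) * v ^+ (e.2 && f.2).

(* The tensor product <u1,v1> (x)_R <u2,v2>, with R-basis the pure tensors *)
(* (i1^a j1^b) (x) (i2^c j2^d), indexed by qidx * qidx.                   *)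
Definition biquat (R : comNzRingType) := {ffun qidx * qidx -> R}.

Definition biquat_mul (R : comNzRingType) (u1 v1 u2 v2 : R)
    (a b : biquat R) : biquat R :=
  [ffun g : qidx * qidx =>
     \sum_(e : qidx * qidx) \sum_(f : qidx * qidx | (qxor e.1 f.1, qxor e.2 f.2) == g)
        a e * b f * (quat_coef u1 v1 e.1 f.1 * quat_coef u2 v2 e.2 f.2)].

Definition biquat_one (R : comNzRingType) : biquat R :=
  [ffun g : qidx * qidx => if g == ((false, false), (false, false)) then 1 else 0].

Definition biquat_is_division (R : comNzRingType) (u1 v1 u2 v2 : R) : Prop :=
  forall a : biquat R, a != 0 ->
    exists b : biquat R,
      biquat_mul u1 v1 u2 v2 a b = biquat_one R /\
      biquat_mul u1 v1 u2 v2 b a = biquat_one R.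

Definition kpoly := {mpoly rat[4]}.
Definition kfield := {fraction kpoly}.
Definition tvar (i : 'I_4) : kfield := FracField.tofrac ('X_i : kpoly).

Definition kx := {fraction {poly kfield}}.
Definition xk : kx := FracField.tofrac ('X : {poly kfield}).
Definition tk (i : 'I_4) : kx := FracField.tofrac ((tvar i)%:P : {poly kfield}).


Definition t1 : kx := tk (@Ordinal 4 0 isT).
Definition t2 : kx := tk (@Ordinal 4 1 isT).
Definition t3 : kx := tk (@Ordinal 4 2 isT).
Definition t4 : kx := tk (@Ordinal 4 3 isT).

Definition cubic : kx := xk * (xk - t1) * (xk - t2).

Definition Kpoly : {poly kx} := 'X^2 - cubic%:P.
Definition Kfun := {poly %/ Kpoly}.

Definition inK (c : kx) : Kfun := in_qpoly Kpoly c%:P.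

(* Main.v *)
Require Import Defs.
From HB Require Import structures.
From mathcomp Require Import all_boot all_order all_algebra.
From mathcomp Require Import fraction qpoly.
From mathcomp Require Import mpoly.
From mathcomp Require Import ring.
Local Open Scope ring_scope.
Set Implicit Arguments. Unset Strict Implicit. Unset Printing Implicit Defensive.
Import Order.TTheory GRing.Theory Num.Theory.

(* Adjoin s = sqrt x, r = sqrt (x - t1), q = sqrt (x - t2), and let j1, j2 be *)
(* the quaternion generators with j1^2 = t3, j2^2 = t4. Then x = s^2,         *)
(* t1 = s^2 - r^2, t2 = s^2 - q^2 and y = s r q, so that, up to denominators, *)
(* A sits inside the polynomial ring Q[s,r,q,j1,j2] with its multiplication   *)
(* twisted by signs: j1 anticommutes with s and q, j2 with r and q, and all   *)
(* other pairs of variables commute. A sign twist does not affect leading     *)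
(* monomials up to sign, so this ring has no zero divisors. Hence neither has *)
(* A, and, being finite-dimensional over Q(t1,..,t4)(x), A is a division      *)
(* algebra.                                                                   *)

(** * Biquaternion algebras *)

(** Since A has degree 4, index 4 means division. An element of A becomes, after scaling by a
    nonzero element of Q[t1,..,t4][x], one with coordinates in the order Q[t1,..,t4][x][y]
    ([Kfun_common_denominator]). The map [to_P] sends this order into Q[s,r,q,j1,j2], and [to_P_eq0]
    says that a coordinate vanishes in K exactly when its image does, so equations pass both ways.
    On the polynomial side the coordinates have degree 0 for the grading [parity], and the 16 basis
    vectors become monomials of 16 distinct degrees. Thus the terms of an element have disjoint
    supports, and the leading coefficient of a twisted product is, up to sign, the product of the
    leading coefficients ([twisted_domain]). So A has no zero divisors ([biquat_Kfun_domain]), and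
    finite dimension gives inverses ([biquat_division_of_domain]). *)

Definition bqidx := (qidx * qidx)%type.
Definition bqxor (e f : bqidx) : bqidx := (qxor e.1 f.1, qxor e.2 f.2).
Definition bqzero : bqidx := ((false, false), (false, false)).

Lemma qxorA : associative qxor.
Proof. by do 3![case=> [[] []]]. Qed.

Lemma qxorC : commutative qxor.
Proof. by do 2![case=> [[] []]]. Qed.

Lemma qxor0 : right_id (false, false) qxor.
Proof. by case=> [[] []]. Qed.

Lemma qxorr e : qxor e e = (false, false).
Proof. by case: e => [[] []]. Qed.

Lemma bqxorA : associative bqxor.
Proof. by move=> e f g; rewrite /bqxor /= !qxorA. Qed.

Lemma bqxorC : commutative bqxor.
Proof. by move=> e f; rewrite /bqxor (qxorC e.1) (qxorC e.2). Qed.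

Lemma bqxor0 : right_id bqzero bqxor.
Proof. by case=> e1 e2; rewrite /bqxor !qxor0. Qed.

Lemma bqxorr e : bqxor e e = bqzero.
Proof. by rewrite /bqxor !qxorr. Qed.

Lemma bqxorK e : involutive (bqxor e).
Proof. by move=> f; rewrite bqxorA bqxorr bqxorC bqxor0. Qed.

Lemma bqxor_eq e f g : (bqxor e f == g) = (f == bqxor e g).
Proof. by rewrite -{1}(bqxorK e g) (inj_eq (can_inj (bqxorK e))). Qed.

Section Biquat.

Variables (R : comNzRingType) (u1 v1 u2 v2 : R).

Definition bqcoef (e f : bqidx) : R :=
  quat_coef u1 v1 e.1 f.1 * quat_coef u2 v2 e.2 f.2.

Local Notation mul := (biquat_mul u1 v1 u2 v2).

(** This 2-cocycle identity is associativity on basis vectors; [biquat_mulA] extends it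
    bilinearly. *)
Lemma quat_coef_cocycle (u v : R) (e f g : qidx) :
  quat_coef u v e f * quat_coef u v (qxor e f) g =
  quat_coef u v f g * quat_coef u v e (qxor f g).
Proof.
by case: e f g => [[] []] [[] []] [[] []]; rewrite /quat_coef /qxor /=; ring.
Qed.

Lemma bqcoef_cocycle e f g :
  bqcoef e f * bqcoef (bqxor e f) g = bqcoef f g * bqcoef e (bqxor f g).
Proof. by rewrite /bqcoef mulrACA !quat_coef_cocycle mulrACA. Qed.

Lemma biquat_mulE (a b : biquat R) g :
  mul a b g = \sum_e a e * b (bqxor e g) * bqcoef e (bqxor e g).
Proof.
rewrite ffunE; apply: eq_bigr => e _.
by rewrite (big_pred1 (bqxor e g)) => [|f]; last exact: (bqxor_eq e f g).
Qed.

Lemma biquat_mulA (a b c : biquat R) : mul a (mul b c) = mul (mul a b) c.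
Proof.
apply/ffunP => g; rewrite [LHS]biquat_mulE [RHS]biquat_mulE.
under eq_bigr => e _ do rewrite biquat_mulE big_distrr big_distrl /=.
under [RHS]eq_bigr => h _ do rewrite biquat_mulE big_distrl big_distrl /=.
rewrite [RHS]exchange_big /=; apply: eq_bigr => e _.
(* On the right [h] is the degree of a product of two basis vectors; after this shift by [e] it is
   the degree of the middle factor, as on the left. *)
rewrite [RHS](reindex_inj (can_inj (bqxorK e))) /=; apply: eq_bigr => h _.
have -> : bqxor (bqxor e h) g = bqxor h (bqxor e g).
  by rewrite bqxorA (bqxorC e h).
rewrite !bqxorK; set k := bqxor h (bqxor e g).
have E : bqcoef e h * bqcoef (bqxor e h) k = bqcoef h k * bqcoef e (bqxor e g).
  by rewrite bqcoef_cocycle {2}/k bqxorK.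
transitivity (a e * b h * c k * (bqcoef h k * bqcoef e (bqxor e g))).
  by ring.
by rewrite -E; ring.
Qed.

Lemma biquat_mulr1 (a : biquat R) : mul a (biquat_one R) = a.
Proof.
apply/ffunP => g; rewrite biquat_mulE (bigD1 g) //= big1 => [|e ne_eg].
  by rewrite ffunE bqxorr /bqcoef /quat_coef /= !andbF !mulr1 addr0.
by rewrite ffunE bqxor_eq bqxor0 eq_sym (negPf ne_eg) mulr0 mul0r.
Qed.

Lemma biquat_mul1r (a : biquat R) : mul (biquat_one R) a = a.
Proof.
apply/ffunP => g; rewrite biquat_mulE (bigD1 bqzero) //= big1 => [|e ne_e0].
  rewrite ffunE eqxx bqxorC bqxor0 /bqcoef /quat_coef /=.
  by rewrite !mulr1 mul1r addr0.
by rewrite ffunE (negPf ne_e0) !mul0r.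
Qed.

Lemma biquat_mulDr (a b c : biquat R) : mul a (b + c) = mul a b + mul a c.
Proof.
apply/ffunP => g; rewrite [RHS]ffunE !biquat_mulE -big_split /=.
by apply: eq_bigr => e _; rewrite ffunE mulrDr mulrDl.
Qed.

End Biquat.

Lemma biquat_mul_map (R S : comNzRingType) (f : {rmorphism R -> S})
    (u1 v1 u2 v2 : R) (a b : biquat R) (u1' v1' u2' v2' : S) (a' b' : biquat S) :
  f u1 = u1' -> f v1 = v1' -> f u2 = u2' -> f v2 = v2' ->
  [ffun e => f (a e)] = a' -> [ffun e => f (b e)] = b' ->
  [ffun e => f (biquat_mul u1 v1 u2 v2 a b e)] = biquat_mul u1' v1' u2' v2' a' b'.
Proof.
move=> <- <- <- <- <- <-; apply/ffunP => g.
rewrite ffunE !biquat_mulE rmorph_sum; apply: eq_bigr => e _.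
by rewrite !ffunE /bqcoef /quat_coef !(rmorphM, rmorphXn, rmorphN1).
Qed.

Section BiquatScale.

Variables (L : comNzRingType) (S : comAlgType L) (u1 v1 u2 v2 : S).
Local Notation mul := (biquat_mul u1 v1 u2 v2).

Lemma biquat_mulZl (c : L) (a b : biquat S) : mul (c *: a) b = c *: mul a b.
Proof.
apply/ffunP => g; rewrite [RHS]ffunE !biquat_mulE scaler_sumr.
by apply: eq_bigr => e _; rewrite ffunE -!scalerAl.
Qed.

Lemma biquat_mulZr (c : L) (a b : biquat S) : mul a (c *: b) = c *: mul a b.
Proof.
apply/ffunP => g; rewrite [RHS]ffunE !biquat_mulE scaler_sumr.
by apply: eq_bigr => e _; rewrite ffunE -scalerAr -scalerAl.
Qed.

End BiquatScale.

(** Left multiplication by [a] is an injective [L]-linear endomorphism of a finite-dimensional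
    space, hence surjective, and a preimage of 1 is a right inverse. *)
Lemma biquat_division_of_domain (L : fieldType) (h : {poly L})
    (u1 v1 u2 v2 : {poly %/ h}) :
  (forall a b : biquat {poly %/ h},
     biquat_mul u1 v1 u2 v2 a b = 0 -> a != 0 -> b = 0) ->
  biquat_is_division u1 v1 u2 v2.
Proof.
move=> dom a a_neq0; set mul := biquat_mul u1 v1 u2 v2.
have mula_lin : linear (mul a).
  by move=> c b b'; rewrite /mul biquat_mulDr biquat_mulZr.
pose Ml := HB.pack_for {linear biquat {poly %/ h} -> biquat {poly %/ h}} (mul a)
   (GRing.isLinear.Build _ _ _ _ (mul a) mula_lin).
have mulaB b b' : mul a (b - b') = mul a b - mul a b' by apply: (raddfB Ml).
pose f : 'End(biquat {poly %/ h}) := linfun Ml.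
have ker_f : lker f == 0%VS.
  apply/lker0P => b b'; rewrite !lfunE /= => eq_bb'.
  by apply/subr0_eq/(dom a) => //; rewrite -/mul mulaB eq_bb' subrr.
pose b := (f^-1)%VF (biquat_one {poly %/ h}).
have ab1 : mul a b = biquat_one {poly %/ h}.
  by have := lker0_lfunVK ker_f (biquat_one {poly %/ h}); rewrite lfunE.
(* The right inverse is also a left one: a(ba - 1) = (ab)a - a = 0, and [a] can be cancelled. *)
exists b; split=> //; apply/subr0_eq/(dom a) => //; rewrite -/mul mulaB.
by rewrite /mul biquat_mulA -/mul ab1 /mul biquat_mul1r biquat_mulr1 subrr.
Qed.

(** * The sign-twisted polynomial ring *)

Definition commsign (R : comNzRingType) (e f : qidx) : R := (-1) ^+ (e.2 && f.1).

(** Once the slots are squares s^2 and j^2, writing basis vectors as commuting monomials in s and j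
    absorbs the structure constants, leaving only the sign of moving j past s. *)
Lemma quat_coef_sqr (R : comNzRingType) (s j : R) (e f : qidx) :
  quat_coef (s ^+ 2) (j ^+ 2) e f * (s ^+ (qxor e f).1 * j ^+ (qxor e f).2) =
  commsign R e f * ((s ^+ e.1 * j ^+ e.2) * (s ^+ f.1 * j ^+ f.2)).
Proof.
by case: e f => [[] []] [[] []]; rewrite /commsign /quat_coef /qxor /=; ring.
Qed.

Definition bqmonomial (R : comNzRingType) (s j1 r j2 : R) (e : bqidx) : R :=
  (s ^+ e.1.1 * j1 ^+ e.1.2) * (r ^+ e.2.1 * j2 ^+ e.2.2).

Lemma bqcoef_sqr (R : comNzRingType) (s j1 r j2 : R) e f :
  bqcoef (s ^+ 2) (j1 ^+ 2) (r ^+ 2) (j2 ^+ 2) e f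
    * bqmonomial s j1 r j2 (bqxor e f) =
  commsign R e.1 f.1 * commsign R e.2 f.2
    * (bqmonomial s j1 r j2 e * bqmonomial s j1 r j2 f).
Proof.
rewrite /bqcoef /bqmonomial /= mulrACA !quat_coef_sqr mulrACA.
by congr (_ * _); exact: mulrACA.
Qed.

Section TwistedPolynomials.

Variable F : idomainType.
Local Notation P := {mpoly F[5]}.

Definition i_s : 'I_5 := @Ordinal 5 0 isT.
Definition i_r : 'I_5 := @Ordinal 5 1 isT.
Definition i_q : 'I_5 := @Ordinal 5 2 isT.
Definition i_j1 : 'I_5 := @Ordinal 5 3 isT.
Definition i_j2 : 'I_5 := @Ordinal 5 4 isT.

(* The (Z/2)^4-grading of A by its basis, in which K has degree 0: here       *)
(* i1 = s and i2 = r, and q = y / (s r) has the degree of s r.                *)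
Definition parity (m : 'X_{1..5}) : bqidx :=
  ((odd (m i_s + m i_q), odd (m i_j1)), (odd (m i_r + m i_q), odd (m i_j2))).

Lemma parityD m n : parity (m + n)%MM = bqxor (parity m) (parity n).
Proof.
have xorbE b c : xorb b c = b (+) c by case: b c => [] [].
by rewrite /parity !mnmDE !oddD /bqxor /qxor /= !xorbE; do !congr (_, _);
  rewrite addbACA.
Qed.

Definition has_parity (e : bqidx) (p : P) : bool :=
  all (fun m => parity m == e) (msupp p).

Lemma has_parityP e p :
  reflect (forall m, m \in msupp p -> parity m = e) (has_parity e p).
Proof. by apply: (iffP allP) => h m /h; [move/eqP | move->]. Qed.

Lemma has_parityM e f p q :
  has_parity e p -> has_parity f q -> has_parity (bqxor e f) (p * q).
Proof.
move=> /has_parityP hp /has_parityP hq; apply/has_parityP => m.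
by move=> /msuppM_le /allpairsP[[m1 m2] /= [/hp <- /hq <- ->]]; exact: parityD.
Qed.

Lemma has_parityD e p q :
  has_parity e p -> has_parity e q -> has_parity e (p + q).
Proof.
move=> /has_parityP hp /has_parityP hq; apply/has_parityP => m.
by move=> /msuppD_le; rewrite mem_cat => /orP[/hp|/hq].
Qed.

Lemma has_parityX m : has_parity (parity m) 'X_[m].
Proof. by rewrite /has_parity msuppX /= eqxx. Qed.

Lemma has_parity1 : has_parity bqzero 1.
Proof. by rewrite /has_parity msupp1 /= /parity !mnm0E. Qed.

Lemma has_parity_Xexp i (b : bool) :
  has_parity (if b then parity U_(i)%MM else bqzero) ('X_i ^+ b).
Proof. by case: b; [exact: has_parityX | exact: has_parity1]. Qed.

Definition weight : bqidx -> P := bqmonomial 'X_i_s 'X_i_j1 'X_i_r 'X_i_j2.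

Lemma has_parity_weight e : has_parity e (weight e).
Proof.
have := has_parityM
  (has_parityM (has_parity_Xexp i_s e.1.1) (has_parity_Xexp i_j1 e.1.2))
  (has_parityM (has_parity_Xexp i_r e.2.1) (has_parity_Xexp i_j2 e.2.2)).
rewrite /parity !mnm1E /= -/(weight e).
by case: e => [[[] []] [[] []]].
Qed.

Lemma weight_neq0 e : weight e != 0.
Proof.
rewrite /weight /bqmonomial !mulf_neq0 // expf_neq0 //;
  by apply/eqP => /(congr1 (fun p => size (msupp p))); rewrite msuppX msupp0.
Qed.

Local Notation S := ('X_i_s : P).
Local Notation Rr := ('X_i_r : P).
Local Notation J1 := ('X_i_j1 : P).
Local Notation J2 := ('X_i_j2 : P).

Definition total (a : biquat P) : P := \sum_e a e * weight e.

Section HomogeneousCoordinates.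

Variable a : biquat P.
Hypothesis a_has_parity : forall e, has_parity bqzero (a e).

Lemma has_parity_term e : has_parity e (a e * weight e).
Proof.
have := has_parityM (a_has_parity e) (has_parity_weight e).
by rewrite bqxorC bqxor0.
Qed.

(** The terms have pairwise distinct parities, so the term at [e] is the component of degree [e] of
    [total a] and no cancellation occurs in the sum. *)
Lemma mcoeff_term e m :
  (a e * weight e)@_m = if e == parity m then (total a)@_m else 0.
Proof.
have vanish f : f != parity m -> (a f * weight f)@_m = 0.
  apply: contraNeq; rewrite -mcoeff_msupp.
  by move=> /(has_parityP _ _ (has_parity_term f)) ->.
case: eqP => [-> | /eqP /vanish //].
by rewrite raddf_sum (bigD1 (parity m)) //= big1 ?addr0.
Qed.

Lemma total_eq0 : total a = 0 -> a = 0.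
Proof.
move=> a0; apply/ffunP => e; rewrite ffunE; apply/eqP.
have: a e * weight e == 0.
  apply/eqP/mpolyP => m; rewrite mcoeff_term a0 mcoeff0.
  by case: ifP.
by rewrite mulf_eq0 (negPf (weight_neq0 e)) orbF.
Qed.

Lemma mlead_term_le e : (mlead (a e * weight e) <= mlead (total a))%O.
Proof.
have [-> | /mlead_supp lead_in] := eqVneq (a e * weight e) 0.
  by rewrite mlead0 le0x.
apply: msupp_le_mlead; rewrite mcoeff_msupp.
move: lead_in; rewrite mcoeff_msupp mcoeff_term.
by case: ifP => // _; rewrite eqxx.
Qed.

End HomogeneousCoordinates.

(* The right-hand side is the sign-twisted product of [total a] and [total b]. *)
Lemma total_mul (a b : biquat P) :
  total (biquat_mul (S ^+ 2) (J1 ^+ 2) (Rr ^+ 2) (J2 ^+ 2) a b) =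
  \sum_e \sum_f commsign P e.1 f.1 * commsign P e.2 f.2 *
     ((a e * weight e) * (b f * weight f)).
Proof.
rewrite /total; under eq_bigr => g _ do rewrite biquat_mulE mulr_suml.
rewrite exchange_big /=; apply: eq_bigr => e _.
rewrite (reindex_inj (can_inj (bqxorK e))) /=; apply: eq_bigr => f _.
by rewrite bqxorK -mulrA bqcoef_sqr mulrCA; congr (_ * _); exact: mulrACA.
Qed.

Lemma mcoeff_commsign e f p m :
  (commsign P e f * p)@_m = (-1) ^+ (e.2 && f.1) * p@_m.
Proof.
by rewrite /commsign; case: (_ && _); rewrite ?mul1r // !mulN1r mcoeffN.
Qed.

Lemma twisted_domain (a b : biquat P) :
  (forall e, has_parity bqzero (a e)) -> (forall e, has_parity bqzero (b e)) ->
  biquat_mul (S ^+ 2) (J1 ^+ 2) (Rr ^+ 2) (J2 ^+ 2) a b = 0 ->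
  a = 0 \/ b = 0.
Proof.
move=> ha hb ab0.
have [/(total_eq0 ha) | a_neq0] := eqVneq (total a) 0; first by left.
have [/(total_eq0 hb) | b_neq0] := eqVneq (total b) 0; first by right.
have := total_mul a b; rewrite ab0 /total big1 => [|e _]; last first.
  by rewrite ffunE mul0r.
set m := mlead (total a); set n := mlead (total b).
move/(congr1 (mcoeff (m + n)%MM)); rewrite mcoeff0 raddf_sum.
under eq_bigr => e _.
  rewrite raddf_sum.
  under eq_bigr => f _.
    (* No term leads beyond [m] (resp. [n]), so the coefficient of a product at [m + n] is the
       product of the coefficients at [m] and [n]; only the terms of degrees [parity m] and
       [parity n] contribute. *)
    rewrite /= -mulrA !mcoeff_commsign mleadcMW ?mlead_term_le //.
    rewrite !mcoeff_term //; over.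
  over.
rewrite (bigD1 (parity m)) //= [X in _ + X]big1 => [|e /negPf ne_e]; last first.
  by rewrite big1 // => f _; rewrite ne_e mul0r !mulr0.
rewrite (bigD1 (parity n)) //= [X in _ + X + _]big1 => [|f /negPf ne_f]; last first.
  by rewrite ne_f !mulr0.
rewrite !eqxx !addr0 => /esym/eqP.
by rewrite !mulf_eq0 !signr_eq0 !mleadc_eq0 (negPf a_neq0) (negPf b_neq0).
Qed.

End TwistedPolynomials.

(** * Clearing denominators *)

Section Denominators.

Definition is_frac_map (R : idomainType) (L : fieldType) (f : R -> L) :=
  forall c : L, exists d n, d != 0 /\ f d * c = f n.

Lemma tofrac_is_frac_map (R : idomainType) :
  is_frac_map (@FracField.tofrac R).
Proof.
move=> c; exists (\d_(repr c)), (\n_(repr c)); split; first exact: denom_ratioP.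
rewrite -[c in _ * c]reprK; unlock FracField.tofrac.
rewrite -[LHS](FracField.pi_mul); apply/eqP; rewrite FracField.equivf_def.
by rewrite /FracField.mulf !numden_Ratio ?mul1r ?mulr1 ?oner_eq0 ?denom_ratioP.
Qed.

Lemma tofrac_inj (A : idomainType) : injective (@FracField.tofrac A).
Proof. by move=> c d /eqP; rewrite tofrac_eq => /eqP. Qed.

Lemma common_denominator (R : idomainType) (L : fieldType)
    (f : {rmorphism R -> L}) (V : lmodType L) (Q : V -> Prop)
    (I : finType) (a : I -> V) :
  (forall d v, Q v -> Q (f d *: v)) ->
  (forall i, exists2 d, d != 0 & Q (f d *: a i)) ->
  exists2 d, d != 0 & forall i, Q (f d *: a i).
Proof.
move=> QZ /fin_all_exists2[d d_neq0 Qd].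
exists (\prod_i d i) => [|i]; first by apply/prodf_neq0.
by rewrite (bigD1 i) //= mulrC rmorphM -scalerA; apply: QZ.
Qed.

Lemma poly_common_denominator (R : idomainType) (L : fieldType)
    (f : {rmorphism R -> L}) (p : {poly L}) :
  is_frac_map f -> exists d n, d != 0 /\ f d *: p = map_poly f n.
Proof.
move=> f_frac; elim/poly_ind: p => [|p c [d [n [d_neq0 En]]]].
  by exists 1, 0; rewrite oner_neq0 rmorph0 scaler0.
have [d' [m [d'_neq0 Em]]] := f_frac c.
exists (d' * d), ((d' *: n) * 'X + (d * m)%:P); rewrite mulf_neq0 //; split=> //.
rewrite [RHS]rmorphD [X in _ = X + _]rmorphM /= map_polyX map_polyC map_polyZ /=.
rewrite scalerDr scalerAl rmorphM -scalerA En.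
by rewrite -[_ *: c%:P]mul_polyC -polyCM mulrAC Em [f (d * m)]rmorphM [f d * f m]mulrC.
Qed.

Lemma tofrac_map_poly_inj (R : idomainType) (L : fieldType)
    (f : {rmorphism R -> L}) :
  injective f -> injective (@FracField.tofrac {poly L} \o map_poly f).
Proof.
move=> f_inj p q /eqP; rewrite tofrac_eq => /eqP.
by apply: map_inj_poly => //; exact: rmorph0.
Qed.

Lemma tofrac_map_poly_is_frac_map (R : idomainType) (L : fieldType)
    (f : {rmorphism R -> L}) :
  injective f -> is_frac_map f ->
  is_frac_map (@FracField.tofrac {poly L} \o map_poly f).
Proof.
move=> f_inj f_frac c; have [d [n [d_neq0 En]]] := tofrac_is_frac_map c.
have [e [m [e_neq0 Em]]] := poly_common_denominator d f_frac.
have [e' [m' [e'_neq0 Em']]] := poly_common_denominator n f_frac.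
have f_neq0 a : a != 0 -> f a != 0 by rewrite -(inj_eq f_inj) rmorph0.
(* From d c = n, e d = m and e' n = m' follows (e' m) c = e m'. *)
exists (e' *: m), (e *: m'); split.
  rewrite -(inj_eq (tofrac_map_poly_inj f_inj)) rmorph0 /= tofrac_eq0.
  by rewrite map_polyZ /= -Em !scaler_eq0 !negb_or !f_neq0.
rewrite /= !map_polyZ /= -Em -Em' -!mul_polyC !tofracM -En.
set x := FracField.tofrac _; set y := FracField.tofrac _.
by rewrite -!mulrA mulrCA.
Qed.

End Denominators.

(** * Remainders modulo a monic quadratic X^2 - c *)

Lemma size_Xn2_subC (A : nzRingType) (c : A) : size ('X^2 - c%:P) = 3%N.
Proof.
rewrite size_polyDl size_polyXn // size_polyN ltnS.
by rewrite (leq_trans (size_polyC_leq1 _)).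
Qed.

Lemma monic_Xn2_subC (A : nzRingType) (c : A) : 'X^2 - c%:P \is monic.
Proof.
rewrite monicE lead_coefDl ?lead_coefXn // size_polyXn size_polyN ltnS.
by rewrite (leq_trans (size_polyC_leq1 _)).
Qed.

Section LinearPolynomials.

Variable A : nzRingType.
Implicit Types n : {poly A}.

Lemma size_linear (r0 r1 : A) : (size (r0%:P + r1%:P * 'X)%R <= 2)%N.
Proof.
by rewrite addrC size_MXaddC; case: ifP => // _; rewrite ltnS size_polyC_leq1.
Qed.

Lemma linear_eq0 (r0 r1 : A) : r0%:P + r1%:P * 'X = 0 -> r0 = 0 /\ r1 = 0.
Proof.
move=> /polyP E; split; [have := E 0%N | have := E 1%N].
  by rewrite coefD coefMX !coefC addr0.
by rewrite coefD coefMX !coefC add0r.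
Qed.

Lemma reduce_mod_Xn2_subC (c : A) n :
  exists q, exists r0, exists r1, n = q * ('X^2 - c%:P) + (r0%:P + r1%:P * 'X).
Proof.
have h_monic := monic_Xn2_subC c; set h := 'X^2 - _ in h_monic *.
pose r := Pdiv.CommonRing.rmodp n h.
exists (Pdiv.CommonRing.rdivp n h), r`_0, r`_1.
rewrite {1}[n](Pdiv.RingMonic.rdivp_eq h_monic) -/r.
have sz_r : (size r < 3)%N.
  by rewrite -(size_Xn2_subC c) Pdiv.CommonRing.ltn_rmodpN0 // monic_neq0.
congr (_ + _); apply/polyP => -[|[|i]].
- by rewrite coefD coefMX !coefC addr0.
- by rewrite coefD coefMX !coefC add0r.
rewrite [LHS]nth_default; last by rewrite -ltnS (leq_trans sz_r).
by rewrite coefD coefMX !coefC addr0.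
Qed.

End LinearPolynomials.

Lemma mpoly_rmorph_eq (n : nat) (R : comNzRingType) (S : nzRingType)
    (f g : {rmorphism {mpoly R[n]} -> S}) :
  (forall c, f c%:MP = g c%:MP) -> (forall i, f 'X_i = g 'X_i) -> f =1 g.
Proof.
move=> eqC eqX p; rewrite [p]mpolyE !rmorph_sum; apply: eq_bigr => m _ /=.
rewrite -mul_mpolyC !rmorphM eqC mpolyXE_id !rmorph_prod; congr (_ * _).
by apply: eq_bigr => i _; rewrite !rmorphXn eqX.
Qed.

Lemma rmorph_cubic (A B : comNzRingType) (f : {rmorphism A -> B}) (x a b : A) :
  f (x * (x - a) * (x - b)) = f x * (f x - f a) * (f x - f b).
Proof. by rewrite !rmorphM !rmorphB. Qed.

Lemma rmorph_reduce (A B : nzRingType) (f : {rmorphism A -> B}) (q h r : A) :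
  f h = 0 -> f (q * h + r) = f r.
Proof. by move=> h0; rewrite rmorphD rmorphM h0 mulr0 add0r. Qed.

(** * Embedding the order of [A] into the twisted polynomial ring *)

Local Notation R := {poly kpoly}.
Local Notation P := {mpoly rat[5]}.
Local Notation S := ('X_i_s : P).
Local Notation Rr := ('X_i_r : P).
Local Notation Qq := ('X_i_q : P).
Local Notation J1 := ('X_i_j1 : P).
Local Notation J2 := ('X_i_j2 : P).

Definition t_images : 4.-tuple P := [tuple S - Rr; S - Qq; J1; J2].

(* The embedding of Q[t1,..,t4][x] is split into this change of coordinates,  *)
(* where the variables of P stand for s^2, r^2, .., and the squaring of all   *)
(* variables, because each of the two maps is visibly injective.              *)
Definition linear_sub : R -> P :=
  horner_eval S \o map_poly (comp_mpoly t_images).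
HB.instance Definition _ := GRing.RMorphism.on linear_sub.

Definition tpoly (i : 'I_4) : R := ('X_i : kpoly)%:P.
Definition pt1 : R := tpoly (@Ordinal 4 0 isT).
Definition pt2 : R := tpoly (@Ordinal 4 1 isT).
Definition pt3 : R := tpoly (@Ordinal 4 2 isT).
Definition pt4 : R := tpoly (@Ordinal 4 3 isT).

Definition inverse_images : 5.-tuple R :=
  [tuple 'X; 'X - pt1; 'X - pt2; pt3; pt4].
Definition linear_inv : P -> R :=
  mmap (polyC \o @mpolyC 4 rat) (tnth inverse_images).
HB.instance Definition _ := GRing.RMorphism.on linear_inv.

Lemma linear_invX i : linear_inv 'X_i = tnth inverse_images i.
Proof. by rewrite /linear_inv mmapX mmap1U. Qed.

Lemma linear_subK : cancel linear_sub linear_inv.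
Proof.
move=> p; rewrite /linear_sub /= /horner_eval.
rewrite -horner_map /= -map_poly_comp /= linear_invX.
(* The composite fixes the coefficients, since x - (x - t1) = t1 and likewise for t2; what is left
   is evaluation of [p] at its own variable. *)
have /eq_map_poly -> : linear_inv \o comp_mpoly t_images =1 polyC.
  apply: mpoly_rmorph_eq => [c | i] /=; first by rewrite comp_mpolyC /linear_inv mmapC.
  rewrite comp_mpolyXU; case: i => [[|[|[|[|//]]]] ?] /=;
    rewrite ?rmorphB /= !linear_invX !(tnth_nth 0) /= ?subKr;
    by congr ('X_ _)%:P; apply: val_inj.
exact: comp_polyXr.
Qed.

Lemma linear_sub_inj : injective linear_sub.
Proof. exact: can_inj linear_subK. Qed.

Definition square_sub : P -> P := comp_mpoly [tuple 'X_i ^+ 2 | i < 5].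
HB.instance Definition _ := GRing.RMorphism.on square_sub.

Lemma square_subX i : square_sub 'X_i = 'X_i ^+ 2.
Proof. by rewrite /square_sub comp_mpolyXU -tnth_nth tnth_mktuple. Qed.

Lemma square_subE p :
  square_sub p = \sum_(m <- msupp p) p@_m *: 'X_[m *+ 2].
Proof.
rewrite /square_sub comp_mpolyEX; apply: eq_bigr => m _; congr (_ *: _).
rewrite comp_mpolyX mpolyXE_id; apply: eq_bigr => i _.
by rewrite tnth_mktuple mulmnE -exprM mulnC.
Qed.

Lemma mcoeff_square_sub p m : (square_sub p)@_(m *+ 2) = p@_m.
Proof.
rewrite square_subE [in RHS](mpolyE p) !raddf_sum; apply: eq_bigr => k _ /=.
rewrite !mcoeffZ !mcoeffX; congr (_ * (_ : bool)%:R).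
apply/eqP/eqP => [/mnmP E | -> //]; apply/mnmP => i.
by have := E i; rewrite !mulmnE => /eqP; rewrite eqn_pmul2r // => /eqP.
Qed.

Lemma mcoeff_square_sub_odd p (m : 'X_{1..5}) i : odd (m i) -> (square_sub p)@_m = 0.
Proof.
move=> odd_mi; rewrite square_subE raddf_sum big1 // => k _ /=.
rewrite mcoeffZ mcoeffX; case: eqP => [E | _]; last by rewrite mulr0.
by move: odd_mi; rewrite -E mulmnE oddM andbF.
Qed.

Lemma has_parity_square_sub p : has_parity bqzero (square_sub p).
Proof.
apply/has_parityP => m; rewrite mcoeff_msupp => m_in.
have even i : odd (m i) = false.
  by apply: contraNF m_in => /mcoeff_square_sub_odd ->.
by rewrite /parity !oddD !even.
Qed.

Definition y_image : P := S * Rr * Qq.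
Definition y_mnm : 'X_{1..5} := (U_(i_s) + U_(i_r) + U_(i_q))%MM.

Lemma y_imageE : y_image = 'X_[y_mnm].
Proof. by rewrite /y_image /y_mnm !mpolyXD. Qed.

Lemma has_parity_y_image : has_parity bqzero y_image.
Proof.
have -> : bqzero = parity y_mnm by rewrite /parity /y_mnm !mnmDE !mnm1E.
by rewrite y_imageE has_parityX.
Qed.

(** This is the independence of 1 and y = s r q over the polynomials in squares: the exponent of s
    is even in the first summand and odd in the second. *)
Lemma square_sub_y_free p q :
  square_sub p + square_sub q * y_image = 0 -> p = 0 /\ q = 0.
Proof.
move=> E.
have q0 : q = 0.
  apply/mpolyP => m; rewrite mcoeff0.
  have /(congr1 (mcoeff (m *+ 2 + y_mnm)%MM)) := E.
  rewrite mcoeffD y_imageE [(m *+ 2 + y_mnm)%MM]addmC mcoeffMX mcoeff_square_sub.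
  rewrite (@mcoeff_square_sub_odd _ _ i_s) ?add0r ?mcoeff0 //.
  by rewrite mnmDE mulmnE /y_mnm !mnmDE !mnm1E oddD oddM andbF.
split=> //; move: E; rewrite q0 /square_sub rmorph0 mul0r addr0 => E.
by apply/mpolyP => m; rewrite -mcoeff_square_sub /square_sub E !mcoeff0.
Qed.

(** * The order Q[t1,..,t4][x][y] and its maps to K and to the polynomial ring *)

Definition denom_map : R -> kx :=
  @FracField.tofrac {poly kfield} \o map_poly (@FracField.tofrac kpoly).
HB.instance Definition _ := GRing.RMorphism.on denom_map.

Lemma denom_map_inj : injective denom_map.
Proof. exact/tofrac_map_poly_inj/tofrac_inj. Qed.

Lemma denom_map_is_frac_map : is_frac_map denom_map.
Proof.
apply: tofrac_map_poly_is_frac_map; first exact: tofrac_inj.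
exact: tofrac_is_frac_map.
Qed.

Lemma denom_mapX : denom_map 'X = xk.
Proof. by rewrite /denom_map /= map_polyX. Qed.

Lemma denom_map_tpoly i : denom_map (tpoly i) = tk i.
Proof. by rewrite /denom_map /= map_polyC. Qed.

Definition cubicR : R := 'X * ('X - pt1) * ('X - pt2).
Definition KpolyR : {poly R} := 'X^2 - cubicR%:P.

Definition to_Kfun : {poly R} -> Kfun := in_qpoly Kpoly \o map_poly denom_map.
HB.instance Definition _ := GRing.RMorphism.on to_Kfun.

Definition to_P : {poly R} -> P :=
  horner_eval y_image \o map_poly (square_sub \o linear_sub).
HB.instance Definition _ := GRing.RMorphism.on to_P.

Lemma map_KpolyR : map_poly denom_map KpolyR = Kpoly.
Proof.
rewrite /KpolyR /Kpoly rmorphB rmorphXn /= map_polyX map_polyC /=.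
congr (_ - _%:P); rewrite /cubic -denom_mapX /t1 /t2 -!denom_map_tpoly.
exact: rmorph_cubic.
Qed.

(** The quotient type is formed modulo [mk_monic Kpoly], which has a default value for a non-monic
    or constant polynomial; here the default does not occur. *)
Lemma mk_monic_Kpoly : mk_monic Kpoly = Kpoly.
Proof. by rewrite /mk_monic /Kpoly size_Xn2_subC monic_Xn2_subC. Qed.

Lemma to_Kfun_KpolyR : to_Kfun KpolyR = 0.
Proof.
rewrite /to_Kfun /= map_KpolyR; apply: val_inj => /=.
by rewrite mk_monic_Kpoly Pdiv.RingMonic.rmodpp // monic_Xn2_subC.
Qed.

Lemma to_PC c : to_P c%:P = square_sub (linear_sub c).
Proof. by rewrite /to_P /= map_polyC /horner_eval hornerC. Qed.

Lemma to_PX : to_P 'X = y_image.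
Proof. by rewrite /to_P /= map_polyX /horner_eval hornerX. Qed.

Lemma linear_subX : linear_sub 'X = S.
Proof. by rewrite /linear_sub /= map_polyX /horner_eval hornerX. Qed.

Lemma linear_sub_tpoly i : linear_sub (tpoly i) = tnth t_images i.
Proof.
by rewrite /linear_sub /= map_polyC /horner_eval hornerC /= comp_mpolyXU -tnth_nth.
Qed.

Lemma linear_sub_cubicR : linear_sub cubicR = S * Rr * Qq.
Proof.
have -> : linear_sub cubicR = linear_sub 'X * (linear_sub 'X - linear_sub pt1)
    * (linear_sub 'X - linear_sub pt2) by exact: rmorph_cubic.
by rewrite linear_subX !linear_sub_tpoly !(tnth_nth 0) /= !subKr.
Qed.

Lemma to_P_KpolyR : to_P KpolyR = 0.
Proof.
rewrite /KpolyR rmorphB rmorphXn /= to_PC to_PX linear_sub_cubicR.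
rewrite !rmorphM /= !square_subX /y_image.
by rewrite !exprMn subrr.
Qed.

Lemma to_Kfun_linear_eq0 (r0 r1 : R) :
  to_Kfun (r0%:P + r1%:P * 'X) = 0 -> r0 = 0 /\ r1 = 0.
Proof.
move=> /(congr1 val) /=.
rewrite mk_monic_Kpoly Pdiv.CommonRing.rmodp_small; last first.
  by rewrite size_Xn2_subC ltnS (leq_trans (size_poly _ _)) // size_linear.
move=> E; apply: linear_eq0; apply: (map_inj_poly denom_map_inj); first exact: rmorph0.
by rewrite E rmorph0.
Qed.

Lemma to_P_to_Kfun_reduce (n : {poly R}) : exists r0, exists r1,
  to_P n = square_sub (linear_sub r0) + square_sub (linear_sub r1) * y_image /\
  to_Kfun n = to_Kfun (r0%:P + r1%:P * 'X).
Proof.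
have [q [r0 [r1 ->]]] := reduce_mod_Xn2_subC cubicR n.
exists r0, r1; split; last exact: rmorph_reduce to_Kfun_KpolyR.
rewrite -!to_PC -to_PX -rmorphM -rmorphD; exact: rmorph_reduce to_P_KpolyR.
Qed.

(** Both maps kill [KpolyR], so each depends only on the remainder r0 + r1 Y, and each vanishes on
    it only if r0 = r1 = 0. *)
Lemma to_P_eq0 n : (to_P n == 0) = (to_Kfun n == 0).
Proof.
have [r0 [r1 [-> ->]]] := to_P_to_Kfun_reduce n.
apply/eqP/eqP => [|/to_Kfun_linear_eq0[-> ->]]; last first.
  by rewrite !rmorph0 mul0r addr0.
move=> /square_sub_y_free[].
rewrite -(rmorph0 linear_sub) => /linear_sub_inj -> /linear_sub_inj ->.
by rewrite mul0r addr0 rmorph0.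
Qed.

(** Squares have degree 0, and so does s r q, because q carries the degree of s r. *)
Lemma has_parity_to_P n : has_parity bqzero (to_P n).
Proof.
have [r0 [r1 [-> _]]] := to_P_to_Kfun_reduce n.
apply: has_parityD; first exact: has_parity_square_sub.
rewrite -[bqzero](bqxorr bqzero).
by rewrite has_parityM ?has_parity_square_sub ?has_parity_y_image.
Qed.

(** * Transfer of products from A to the twisted polynomial ring *)

Lemma Kfun_common_denominator (a : biquat Kfun) :
  exists2 d, d != 0 &
    exists n : biquat {poly R}, [ffun e => to_Kfun (n e)] = denom_map d *: a.
Proof.
have QZ (d : R) (v : Kfun) : (exists n, to_Kfun n = v) ->
    exists n, to_Kfun n = denom_map d *: v.
  move=> [n <-]; exists (d *: n).
  by rewrite /to_Kfun /= map_polyZ /= in_qpolyZ.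
have Qa e : exists2 d, d != 0 & exists n, to_Kfun n = denom_map d *: a e.
  have [d [n [d_neq0 En]]] :=
    poly_common_denominator (val (a e)) denom_map_is_frac_map.
  exists d => //; exists n; rewrite /to_Kfun /= -En in_qpolyZ; congr (_ *: _).
  (* The representative [val (a e)] is already reduced, so projecting it back returns [a e]. *)
  by apply: val_inj; rewrite /= Pdiv.CommonRing.rmodp_small // size_mk_monic.
have [d d_neq0 /fin_all_exists[n En]] := common_denominator QZ Qa.
exists d => //; exists [ffun e => n e].
by apply/ffunP => e; rewrite !ffunE En.
Qed.

Local Notation mulK :=
  (biquat_mul (inK xk) (inK t3) (inK (xk - t1)) (inK t4)).

Lemma to_KfunC (c : R) : to_Kfun c%:P = inK (denom_map c).
Proof. by rewrite /to_Kfun /= map_polyC. Qed.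

Lemma to_Kfun_x : to_Kfun 'X%:P = inK xk.
Proof. by rewrite to_KfunC denom_mapX. Qed.

Lemma to_Kfun_t3 : to_Kfun pt3%:P = inK t3.
Proof. by rewrite to_KfunC denom_map_tpoly. Qed.

Lemma to_Kfun_t4 : to_Kfun pt4%:P = inK t4.
Proof. by rewrite to_KfunC denom_map_tpoly. Qed.

Lemma to_Kfun_xt1 : to_Kfun ('X - pt1)%:P = inK (xk - t1).
Proof.
rewrite to_KfunC; have -> : denom_map ('X - pt1) = denom_map 'X - denom_map pt1.
  exact: rmorphB.
by rewrite denom_mapX denom_map_tpoly.
Qed.

Lemma to_P_x : to_P 'X%:P = 'X_i_s ^+ 2.
Proof. by rewrite to_PC linear_subX square_subX. Qed.

Lemma to_P_t3 : to_P pt3%:P = 'X_i_j1 ^+ 2.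
Proof. by rewrite to_PC linear_sub_tpoly (tnth_nth 0) /= square_subX. Qed.

Lemma to_P_t4 : to_P pt4%:P = 'X_i_j2 ^+ 2.
Proof. by rewrite to_PC linear_sub_tpoly (tnth_nth 0) /= square_subX. Qed.

Lemma to_P_xt1 : to_P ('X - pt1)%:P = 'X_i_r ^+ 2.
Proof.
rewrite to_PC; have -> : linear_sub ('X - pt1) = linear_sub 'X - linear_sub pt1.
  exact: rmorphB.
by rewrite linear_subX linear_sub_tpoly (tnth_nth 0) /= subKr square_subX.
Qed.

(** Numerators [n], [n'] of [a], [b] are multiplied over [{poly R}], where the product need not
    vanish; only its image in K does, and [to_P_eq0] then kills its image in [P]. *)
Lemma biquat_Kfun_domain (a b : biquat Kfun) : mulK a b = 0 -> a != 0 -> b = 0.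
Proof.
move=> ab0 a_neq0.
have [d d_neq0 [n En]] := Kfun_common_denominator a.
have [d' d'_neq0 [n' En']] := Kfun_common_denominator b.
have scale_eq0 (c : R) (v : biquat Kfun) : c != 0 -> denom_map c *: v = 0 -> v = 0.
  move=> c_neq0 /eqP; rewrite scaler_eq0 -(rmorph0 denom_map).
  by rewrite (inj_eq denom_map_inj) (negPf c_neq0) => /eqP.
have from_P (m : biquat {poly R}) :
    [ffun e => to_P (m e)] = 0 -> [ffun e => to_Kfun (m e)] = 0.
  move=> m0; apply/ffunP => e; rewrite !ffunE; apply/eqP; rewrite -to_P_eq0.
  by have /ffunP/(_ e) := m0; rewrite !ffunE => ->.
pose nn' := biquat_mul 'X%:P pt3%:P ('X - pt1)%:P pt4%:P n n'.
have K0 : [ffun e => to_Kfun (nn' e)] = 0.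
  rewrite (biquat_mul_map to_Kfun_x to_Kfun_t3 to_Kfun_xt1 to_Kfun_t4 En En').
  by rewrite biquat_mulZl biquat_mulZr ab0 !scaler0.
have P0 : biquat_mul ('X_i_s ^+ 2) ('X_i_j1 ^+ 2) ('X_i_r ^+ 2) ('X_i_j2 ^+ 2)
            [ffun e => to_P (n e)] [ffun e => to_P (n' e)] = 0.
  rewrite -(biquat_mul_map to_P_x to_P_t3 to_P_xt1 to_P_t4 erefl erefl).
  apply/ffunP => e; rewrite !ffunE; apply/eqP; rewrite to_P_eq0.
  by have /ffunP/(_ e) := K0; rewrite !ffunE => ->.
have par_to_P (m : biquat {poly R}) e :
    has_parity bqzero ([ffun e => to_P (m e)] e).
  by rewrite ffunE has_parity_to_P.
case: (twisted_domain (par_to_P n) (par_to_P n') P0) => /from_P.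
  by rewrite En => /(scale_eq0 _ _ d_neq0) a0; rewrite a0 eqxx in a_neq0.
by rewrite En' => /(scale_eq0 _ _ d'_neq0).
Qed.

(* A = <x, t3> (x)_K <x - t1, t4> over K is a division algebra (index 4). *)
Theorem theorem6p1 :
  biquat_is_division (inK xk) (inK t3) (inK (xk - t1)) (inK t4).
Proof. exact/biquat_division_of_domain/biquat_Kfun_domain. Qed.
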